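(* Let $\Gamma$ be a group generated by a finite symmetric set $S=S^{-1}\subset\Gamma$, and suppose that there are real constants $0<\alpha\le 1$, $C>0$ and $b>0$ such that the growth function satisfies $\gamma_S(n-1)\ge C e^{b n^{\alpha}}$ for every integer $n\ge 1$. Then there is a function $h:\{2,3,4,\dots\}\to\mathbb{R}$ with $\lim_{m\to\infty} h(m)/\log(m)=0$ and $\log(m)+h(m)>0$ for all $m\ge 2$, such that for every finite subset $D\subset\Gamma$ with at least two elements, $$\frac{|\partial_S D|}{|D|}\ \ge\ \left(\frac{b}{\log(|D|)+h(|D|)}\right)^{1/\alpha}.$$
   Context: For an integer $r\ge 0$, $B_S(r)\subset\Gamma$ is the set of elements that can be written as a product of at most $r$ elements of $S$ (so $B_S(0)=\{e\}$), and $\gamma_S(r)=|B_S(r)|$. The (inner) boundary of $D\subset\Gamma$ is $\partial_S D=\{x\in D : \exists s\in S,\ sx\notin D\}$. *)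

(* Defs.v *)
From HB Require Import structures.
From mathcomp Require Import all_boot all_order all_algebra.
From mathcomp Require Import finmap.
From mathcomp Require Import all_classical all_reals all_analysis.

Set Implicit Arguments.
Unset Strict Implicit.
Unset Printing Implicit Defensive.

Import Order.TTheory GRing.Theory Num.Theory.
Import numFieldNormedType.Exports.

Local Open Scope classical_set_scope.
Local Open Scope group_scope.

Section Growth.
Variable Gamma : groupType.
Implicit Types (S D : {fset Gamma}) (r : nat).

Definition generates S : Prop :=
  smallest (fun H : set Gamma => group_closed (mem H)) [set` S] = setT.

Definition symmetric_fset S : Prop := S = [fset s^-1 | s in S]%fset.

Definition ball S r : set Gamma :=
  [set x | exists w : seq Gamma,
     [/\ all (fun s => s \in S) w, (size w <= r)%N & x = \prod_(s <- w) s]].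

Lemma finite_ball S r : finite_set (ball S r).
Proof.
elim: r => [|r IH].
  apply: (sub_finite_set _ (finite_set1 1)) => x [w [_]].
  by rewrite leqn0 size_eq0 => /eqP -> ->; rewrite big_nil.
have fin2 : finite_set
    ([set s * y | s in [set` S] & y in ball S r] `|` [set 1]).
  rewrite finite_setU; split; last exact: finite_set1.
  exact: finite_image2 (finite_fset S) IH.
apply: (sub_finite_set _ fin2) => x [[|s w] [/= aw sw ->]].
  by right; rewrite big_nil.
left; rewrite big_cons; case/andP: aw => sS wS.
by exists s => //; exists (\prod_(t <- w) t) => //; exists w.
Qed.

(* fset_set is junk on infinite sets; finite_ball rules this out. *)
Definition growth S r : nat := #|` fset_set (ball S r)|.

Definition inner_boundary S D : {fset Gamma} :=
  [fset x in D | [exists s : S, val s * x \notin D]]%fset.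

End Growth.

(* Main.v *)
Require Import Defs.
From HB Require Import structures.
From mathcomp Require Import all_boot all_order all_algebra.
From mathcomp Require Import finmap.
From mathcomp Require Import all_classical all_reals all_analysis.
From mathcomp Require Import ring lra.

Import Order.TTheory GRing.Theory Num.Theory.
Import numFieldNormedType.Exports.

(* If gamma(r) >= l |D|, average over g in the ball of radius r the number of
   x in D with g x outside D: it is at least (1 - 1/l) |D|, since each x has at
   most |D| translates in D, and at most r |boundary D|, since each exiting path
   crosses the boundary.  Hence |boundary D| / |D| >= (1 - 1/l) / r.  The growth
   hypothesis allows r <= ((ln |D| + ln l - ln C) / b)^(1/alpha), and letting l
   tend to infinity slowly with |D| gives the sharp constant b. *)

Local Open Scope classical_set_scope.
Local Open Scope ring_scope.

Lemma sum_seq_const (T : Type) (s : seq T) (n : nat) :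
  (\sum_(x <- s) n = size s * n)%N.
Proof. by rewrite big_const_seq count_predT iter_addn_0 mulnC. Qed.

Lemma sum_pred_count (T : Type) (s : seq T) (P : pred T) :
  (\sum_(x <- s) P x = count P s)%N.
Proof. by elim: s => [|x s IH]; rewrite ?big_nil// big_cons IH. Qed.

Section Folner.
Variable Gamma : groupType.
Implicit Types (S D B : {fset Gamma}) (g : Gamma) (w : seq Gamma).

Lemma count_mulg_le g (s t : seq Gamma) :
  uniq s -> (count (fun x => (g * x)%g \in t) s <= size t)%N.
Proof.
move=> us; rewrite -size_filter -(size_map (fun x => (g * x)%g)).
apply: uniq_leq_size; first by rewrite map_inj_uniq ?filter_uniq//; exact: mulgI.
by move=> _ /mapP[x + ->]; rewrite mem_filter => /andP[].
Qed.

Lemma count_mulgr_le g (s t : seq Gamma) :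
  uniq s -> (count (fun x => (x * g)%g \in t) s <= size t)%N.
Proof.
move=> us; rewrite -size_filter -(size_map (fun x => (x * g)%g)).
apply: uniq_leq_size; first by rewrite map_inj_uniq ?filter_uniq//; exact: mulIg.
by move=> _ /mapP[x + ->]; rewrite mem_filter => /andP[].
Qed.

(* Following x, s_k x, s_(k-1) s_k x, ..., the last point before the first exit
   from D lies in the boundary, and it determines x once its index along that path is known. *)
Lemma count_escape_le S D w : all (fun s => s \in S) w ->
  (count (fun x => (\prod_(s <- w) s * x)%g \notin D) D
     <= size w * #|` inner_boundary S D|)%N.
Proof.
elim: w => [_|s w IH /= /andP[sS wS]].
  rewrite leqNgt -has_count; apply/hasPn => x xD.
  by rewrite big_nil mul1g negbK.
rewrite big_cons mulSn addnC.
set g := (\prod_(t <- w) t)%g in IH *.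
apply: leq_trans (leq_add (IH wS) (@count_mulg_le g D (inner_boundary S D) (fset_uniq D))).
(* If [s g x] is outside [D], then either [g x] already is, or [g x] lies in the boundary with [s]
   as witness. *)
rewrite -count_predUI; apply: leq_trans (leq_addr _ _); apply: sub_count => x /=.
rewrite -mulgA => sgD; have [gD|//] := boolP ((g * x)%g \in D).
rewrite /inner_boundary !inE/= gD/=; apply/existsP.
by exists [` sS]%fset.
Qed.

Lemma in_ball S r g : g \in fset_set (Defs.ball S r) ->
  exists w, [/\ all (fun s => s \in S) w, (size w <= r)%N & g = (\prod_(s <- w) s)%g].
Proof. by rewrite in_fset_set ?inE//; exact: finite_ball. Qed.

(** Double count of the pairs [(x, g)] with [x] in [D] and [g] in the ball. For fixed [x], right
    translation by [x] is injective, so at most |D| of the [g] keep [g x] in [D]; for fixed [g], a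
    word of length at most [r] bounds the escaping [x]. *)
Lemma boundary_growth S D r :
  (#|` D| * growth S r <=
     #|` D| * #|` D| + growth S r * (r * #|` inner_boundary S D|))%N.
Proof.
set B := fset_set (Defs.ball S r); rewrite -[growth S r]/(size B).
have -> : (#|` D| * size B = \sum_(x <- D) \sum_(g <- B)
    (((g * x)%g \in D) + ((g * x)%g \notin D)))%N.
  rewrite (eq_bigr (fun=> size B)) => [|x _]; first by rewrite sum_seq_const.
  rewrite (eq_bigr (fun=> 1%N)) => [|g _]; first by rewrite sum1_size.
  by case: ((g * x)%g \in D).
under [leqLHS]eq_bigr do rewrite big_split/=.
rewrite big_split/= leq_add//.
  rewrite -sum_seq_const leq_sum// => x _; rewrite sum_pred_count.
  exact: count_mulgr_le (fset_uniq _).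
rewrite exchange_big/= -sum_seq_const big_seq [leqRHS]big_seq leq_sum// => g gB.
have [w [wS wr ->]] := in_ball _ _ _ gB.
rewrite sum_pred_count.
apply: leq_trans (count_escape_le _ _ _ wS) _.
by rewrite leq_mul2r wr orbT.
Qed.

End Folner.

(** Dividing [boundary_growth] by |D| times the growth turns its first term into |D| / growth, which
    is at most [l^-1]. *)
Lemma boundary_ratio_ge (R : realType) (Gamma : groupType)
    (S D : {fset Gamma}) (r : nat) (l : R) :
  0 < l -> (0 < #|` D|)%N -> l * #|` D|%:R <= (growth S r)%:R ->
  1 - l^-1 <= r%:R * (#|` inner_boundary S D|%:R / #|` D|%:R).
Proof.
move=> l0 D0 lDG; have := boundary_growth _ S D r.
rewrite -(ler_nat R) natrD !natrM.
set d : R := #|` D|%:R in lDG *; set G : R := (growth S r)%:R in lDG *.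
set e : R := #|` inner_boundary S D|%:R => main.
have d0 : 0 < d by rewrite ltr0n.
have G0 : 0 < G by apply: lt_le_trans lDG; rewrite mulr_gt0.
have dG : d <= l^-1 * G by rewrite ler_pdivlMl.
rewrite mulrA ler_pdivlMr// -(ler_pM2r G0).
have : d * d <= d * (l^-1 * G) by rewrite ler_wpM2l// ltW.
nra.
Qed.

Section Log.
Variables (R : realType) (c : R).

Local Notation t m := (ln (m%:R : R)).
Local Notation s m := (Num.sqrt (t m)).

(* This is h for the choice l = exp (sqrt (ln m)), with c = ln (min C 1): l tends
   to infinity, while ln l is negligible with respect to ln m. *)
Definition log_correction (m : nat) : R :=
  (t m + s m - c) / (1 - (expR (s m))^-1) - t m.

Lemma ln_natr_cvgy : t m @[m --> \oo] --> +oo.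
Proof.
apply/cvgryPge => A; near=> m.
have m0 : (0 < m)%N by near: m; exists 1%N.
rewrite -[A]expRK ler_ln ?posrE ?expR_gt0 ?ltr0n//.
near: m; exact: (cvgry_ge (@cvgr_idn R)).
Unshelve. all: by end_near. Qed.

Lemma sqrt_ln_natr_cvgy : s m @[m --> \oo] --> +oo.
Proof.
apply/cvgryPge => A; near=> m.
apply: le_trans (ler_norm A) _; rewrite -sqrtr_sqr ler_wsqrtr//.
near: m; exact: (cvgry_ge ln_natr_cvgy).
Unshelve. all: by end_near. Qed.

Lemma log_correction_cvg0 : log_correction m / ln (m%:R : R) @[m --> \oo] --> (0 : R).
Proof.
have sV0 : (s m)^-1 @[m --> \oo] --> (0 : R).
  by apply/gtr0_cvgV0; [exact: (cvgry_gt sqrt_ln_natr_cvgy)|exact: sqrt_ln_natr_cvgy].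
have eV0 : (expR (s m))^-1 @[m --> \oo] --> (0 : R).
  under eq_fun do rewrite -expRN.
  exact: (cvg_comp _ _ sqrt_ln_natr_cvgy (@cvgr_expR R)).
have numer : 1 + (s m)^-1 - c * ((s m)^-1 * (s m)^-1) @[m --> \oo] --> (1 : R).
  have := cvgB (cvgD (cvg_cst (1 : R^o)) sV0) (cvgM (cvg_cst (c : R^o)) (cvgM sV0 sV0)).
  by rewrite !mulr0 addr0 subr0; exact.
have denom0 : 1 - (expR (s m))^-1 @[m --> \oo] --> (1 : R).
  by have := cvgB (cvg_cst (1 : R^o)) eV0; rewrite subr0; exact.
have denom : (1 - (expR (s m))^-1)^-1 @[m --> \oo] --> (1 : R).
  by have := cvgV (oner_neq0 R) denom0; rewrite invr1; exact.
(* Once [s m > 0], this is the quotient itself, divided through using [t m = s m ^+ 2]. *)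
suff : (1 + (s m)^-1 - c * ((s m)^-1 * (s m)^-1)) * (1 - (expR (s m))^-1)^-1 - 1
    @[m --> \oo] --> (0 : R).
  apply: cvg_trans; apply: near_eq_cvg; near=> m.
  have s0 : 0 < s m by near: m; exact: (cvgry_gt sqrt_ln_natr_cvgy).
  have sE : s m ^+ 2 = t m by rewrite sqr_sqrtr// ltW// -sqrtr_gt0.
  have : 1 - (expR (s m))^-1 != 0.
    by rewrite gt_eqF// subr_gt0 invf_lt1 ?expR_gt0// expR_gt1.
  rewrite /= /log_correction; move: (t m) (s m) s0 sE => _ x x0 <-.
  by set u := (expR x)^-1 => u1; field; rewrite (gt_eqF x0) u1.
have := cvgB (cvgM numer denom) (cvg_cst (1 : R^o)).
by rewrite mulr1 subrr; exact.
Unshelve. all: by end_near. Qed.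

End Log.

Theorem corollary3p8 (R : realType) (Gamma : groupType) (S : {fset Gamma})
    (alpha C b : R) :
  symmetric_fset S -> generates S ->
  0 < alpha -> alpha <= 1 -> 0 < C -> 0 < b ->
  (forall n : nat, (1 <= n)%N ->
     C * expR (b * n%:R `^ alpha) <= (growth S n.-1)%:R) ->
  exists h : nat -> R,
    [/\ h m / ln (m%:R : R) @[m --> \oo] --> (0 : R),
        (forall m : nat, (2 <= m)%N -> 0 < ln m%:R + h m)
      & forall D : {fset Gamma}, (2 <= #|` D|)%N ->
          (b / (ln #|` D|%:R + h #|` D|)) `^ (1 / alpha)
            <= #|` inner_boundary S D|%:R / #|` D|%:R].
Proof.
move=> _ _ a0 a1 C0 b0 growS.
(* Capping [C] at 1 only weakens the growth bound and makes [c <= 0], so that [t + s - c] stays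
   positive for every [m >= 2]. *)
pose C' := Num.min C 1; have C'0 : 0 < C' by rewrite lt_min C0/=.
pose c := ln C'; have c0 : c <= 0 by rewrite ln_le0// ge_min lexx orbT.
have pos m : (2 <= m)%N -> [/\ 0 < ln (m%:R : R), 0 < Num.sqrt (ln (m%:R : R))
    & 0 < 1 - (expR (Num.sqrt (ln (m%:R : R))))^-1].
  move=> m2; have t0 : 0 < ln (m%:R : R) by rewrite ln_gt0// ltr1n.
  have s0 : 0 < Num.sqrt (ln (m%:R : R)) by rewrite sqrtr_gt0.
  by split=> //; rewrite subr_gt0 invf_lt1 ?expR_gt0// expR_gt1.
exists (log_correction R c); split.
- exact: log_correction_cvg0.
- move=> m /pos[t0 s0 e0]; rewrite /log_correction addrC subrK divr_gt0//; lra.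
move=> D D2; rewrite /log_correction addrC subrK.
set m := #|` D| in D2 *; have [t0 s0 e0] := pos _ D2.
have m0 : (0 < m)%N by exact: ltnW.
set t := ln _ in t0 s0 e0 *; set s := Num.sqrt t in s0 e0 *.
set l := expR s in e0 *; set T := t + s - c.
have T0 : 0 < T by rewrite /T; lra.
pose q := (T / b) `^ (1 / alpha).
have q0 : 0 < q by rewrite powR_gt0// divr_gt0.
(* Now [r <= q < r + 1]: the growth hypothesis at [n = r + 1] bounds the ball of radius [r], so
   rounding costs nothing. *)
pose r := Num.trunc q.
have lDG : l * m%:R <= (growth S r)%:R.
  apply: le_trans (growS r.+1 isT).
  have -> : l * m%:R = C' * expR T.
    rewrite /T !expRD expRN /c lnK ?posrE// /t lnK ?posrE ?ltr0n//.
    by rewrite mulrC mulrCA mulfV ?mulr1// gt_eqF.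
  apply: ler_pM; [exact: ltW|exact: expR_ge0|by rewrite ge_min lexx|].
  rewrite ler_expR mulrC -ler_pdivrMr//.
  have -> : T / b = q `^ alpha.
    by rewrite -powRrM div1r mulVf ?gt_eqF// powRr1// ltW// divr_gt0.
  rewrite ge0_ler_powR ?nnegrE ?ler0n//; [exact: ltW|exact: ltW|].
  exact/ltW/truncnS_gt.
have rq : r%:R <= q by rewrite truncn_le ltW.
have key := @boundary_ratio_ge R Gamma S D r l (expR_gt0 _) m0 lDG.
set e := _ / m%:R in key *.
have e_ge0 : 0 <= e by rewrite divr_ge0.
have -> : b / (T / (1 - l^-1)) = (T / b)^-1 * (1 - l^-1).
  by rewrite !invf_div mulrA mulrAC.
have Tb0 : 0 <= T / b by rewrite divr_ge0 ?ltW.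
have qV : (T / b)^-1 `^ (1 / alpha) = q^-1.
  by rewrite -[(T / b)^-1]powR_inv1// powRAC powR_inv1// ltW.
rewrite powRM ?qV ?invr_ge0 ?(ltW e0)// ler_pdivrMl//.
(* The factor [1 - l^-1] sits inside the power; as it lies in (0, 1] and [1 / alpha >= 1], the power
   only shrinks it. This is where [alpha <= 1] enters. *)
apply: (@le_trans _ _ (1 - l^-1)); last first.
  by apply: le_trans key _; rewrite ler_wpM2r.
apply: ge1r_powR; first by rewrite e0 gerBl invr_ge0 expR_ge0.
by rewrite div1r invf_ge1.
Qed.
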